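(* The minimal logic of implicative $\wedge$-semilattices is complete in the class $\mathbb{S}$ of frames: if $[\![\varphi]\!]_{\mathfrak{M}}\subseteq[\![\psi]\!]_{\mathfrak{M}}$ for every model $\mathfrak{M}=(\mathfrak{F},V)$ on a frame $\mathfrak{F}\in\mathbb{S}$, then $\varphi\vdash\psi$ is provable.
   Context: Logic (integral case, the truth constant being identified with $\top$). Sentences: $\varphi::=p_i\,(i\in\mathbb{N})\mid\top\mid\varphi\wedge\varphi\mid\varphi\to\varphi$. Sequents $\varphi\vdash\psi$ are generated by: $\varphi\vdash\varphi$; $\varphi\vdash\top$; cut; uniform substitution; the two-way rule $\varphi\vdash\psi$ iff $\top\vdash\varphi\to\psi$; from $\psi\vdash\vartheta$ infer $\varphi\to\psi\vdash\varphi\to\vartheta$ and $\vartheta\to\varphi\vdash\psi\to\varphi$; from $\varphi\vdash\vartheta$ infer $\varphi\wedge\psi\vdash\vartheta$; from $\psi\vdash\vartheta$ infer $\varphi\wedge\psi\vdash\vartheta$; from $\varphi\vdash\psi$ and $\varphi\vdash\vartheta$ infer $\varphi\vdash\psi\wedge\vartheta$; and the axiom $(\varphi\to\psi)\wedge(\varphi\to\vartheta)\vdash\varphi\to(\psi\wedge\vartheta)$. Frames. $\mathfrak{F}=(W_1,W_\partial,I,T)$: $W_1,W_\partial$ nonempty sets (not necessarily disjoint), $I\subseteq W_1\times W_\partial$, $T\subseteq W_\partial\times(W_1\times W_\partial)$. Let $\perp$ be the complement of $I$. For $A\subseteq W_1$, $A'=\{y\in W_\partial\mid\forall x\in A\;x\perp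 y\}$; for $B\subseteq W_\partial$, $B'=\{x\in W_1\mid\forall y\in B\;x\perp y\}$. Galois sets are subsets $G$ of $W_1$ (stable) or $W_\partial$ (co-stable) with $G=G''$. $Txv=\{y\in W_\partial\mid yTxv\}$; the Galois dual $T'$ is given by $uT'xv$ iff $u\in(Txv)'$. $\mathbb{S}$ is the class of frames satisfying: (F1) for all $x\in W_1,v\in W_\partial$, $Txv$ is a Galois set; (F2) for all $x\in W_1,v\in W_\partial$: $x\perp v$ iff $uT'xv$ for all $u\in W_1$; (F3) for all $x,z\in W_1$ the section $\{y\in W_\partial\mid xT'zy\}$ is a Galois (co-stable) set. Models. $V$ assigns a Galois stable set $V(p_i)\subseteq W_1$ to each $p_i$. $[\![p_i]\!]=V(p_i)$, $[\![\top]\!]=W_1$, $[\![\varphi\wedge\psi]\!]=[\![\varphi]\!]\cap[\![\psi]\!]$, $[\![\varphi\to\psi]\!]=\{u\in W_1\mid\forall x\in[\![\varphi]\!]\,\forall v\in[\![\psi]\!]'\;uT'xv\}$. *)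

(* Defs.v *)
From mathcomp Require Import all_boot.
From mathcomp Require Export classical_sets.

Set Implicit Arguments.
Unset Strict Implicit.
Unset Printing Implicit Defensive.

Local Open Scope classical_set_scope.

Inductive sentence : Type :=
  | Var of nat
  | Top
  | And of sentence & sentence
  | Imp of sentence & sentence.

Declare Scope sentence_scope.
Delimit Scope sentence_scope with sent.
Bind Scope sentence_scope with sentence.
Notation "⊤" := Top (at level 0) : sentence_scope.
Notation "phi ⊓ psi" := (And phi psi)
  (at level 40, left associativity) : sentence_scope.
Notation "phi ⇒ psi" := (Imp phi psi)
  (at level 55, right associativity) : sentence_scope.

Fixpoint subst (s : nat -> sentence) (phi : sentence) : sentence :=
  match phi with
  | Var i => s i
  | Top => Top
  | And phi1 phi2 => And (subst s phi1) (subst s phi2)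
  | Imp phi1 phi2 => Imp (subst s phi1) (subst s phi2)
  end.

Reserved Notation "phi ⊢ psi" (at level 70, no associativity).

Inductive provable : sentence -> sentence -> Prop :=
  | prov_refl phi : phi ⊢ phi
  | prov_top phi : phi ⊢ ⊤
  | prov_cut phi psi theta : phi ⊢ psi -> psi ⊢ theta -> phi ⊢ theta
  | prov_subst (s : nat -> sentence) phi psi :
      phi ⊢ psi -> subst s phi ⊢ subst s psi
  | prov_imp_intro phi psi : phi ⊢ psi -> ⊤ ⊢ phi ⇒ psi
  | prov_imp_elim phi psi : ⊤ ⊢ phi ⇒ psi -> phi ⊢ psi
  | prov_imp_mono phi psi theta : psi ⊢ theta -> phi ⇒ psi ⊢ phi ⇒ theta
  | prov_imp_anti phi psi theta : psi ⊢ theta -> theta ⇒ phi ⊢ psi ⇒ phi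
  | prov_and_l phi psi theta : phi ⊢ theta -> phi ⊓ psi ⊢ theta
  | prov_and_r phi psi theta : psi ⊢ theta -> phi ⊓ psi ⊢ theta
  | prov_and_intro phi psi theta :
      phi ⊢ psi -> phi ⊢ theta -> phi ⊢ psi ⊓ theta
  | prov_imp_and phi psi theta :
      (phi ⇒ psi) ⊓ (phi ⇒ theta) ⊢ phi ⇒ (psi ⊓ theta)
where "phi ⊢ psi" := (provable phi%sent psi%sent).

(* The two sorts are independent types, so they may coincide but are not
   assumed to be disjoint or related. *)
Record frame : Type := Frame {
  W1 : Type;
  Wd : Type;
  W1_inhabited : inhabited W1;
  Wd_inhabited : inhabited Wd;
  Irel : W1 -> Wd -> Prop;
  Trel : Wd -> W1 -> Wd -> Prop (* [Trel y x v] is yTxv: the output comes first *)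
}.

Arguments Irel {f} _ _.
Arguments Trel {f} _ _ _.

Section FrameTheory.
Variable F : frame.
Implicit Types (x z u : W1 F) (y v : Wd F).

Definition perp x y : Prop := ~ Irel x y.

Definition polar1 (A : set (W1 F)) : set (Wd F) :=
  [set y | forall x, A x -> perp x y].

Definition polard (B : set (Wd F)) : set (W1 F) :=
  [set x | forall y, B y -> perp x y].

Definition stable (A : set (W1 F)) : Prop := A = polard (polar1 A).

Definition costable (B : set (Wd F)) : Prop := B = polar1 (polard B).

Definition Tsec x v : set (Wd F) := [set y | Trel y x v].

Definition Tdual u x v : Prop := polard (Tsec x v) u.

Record frame_class_S : Prop := FrameClassS {
  F1 : forall x v, costable (Tsec x v);
  F2 : forall x v, perp x v <-> (forall u, Tdual u x v);
  F3 : forall x z, costable [set y | Tdual x z y]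
}.

End FrameTheory.

Record model : Type := Model {
  model_frame :> frame;
  V : nat -> set (W1 model_frame);
  V_stable : forall i, stable (V i)
}.

Section Interpretation.
Variable M : model.

Fixpoint interp (phi : sentence) : set (W1 M) :=
  match phi with
  | Var i => V i
  | Top => setT
  | And phi1 phi2 => interp phi1 `&` interp phi2
  | Imp phi1 phi2 =>
      [set u | forall x v,
         interp phi1 x -> polar1 (interp phi2) v -> Tdual u x v]
  end.

End Interpretation.

Arguments interp M phi : clear implicits.

(* Main.v *)
(* Canonical model. The points of the first sort are the filters of sentences;
   those of the second sort can be taken to be arbitrary sets of sentences
   instead of ideals, with [x] orthogonal to [y] when they share a sentence. The
   dual relation [u T' x v] then says that [a ⇒ b] lies in [u] for some [a] in
   [x] and [b] in [v]. The section condition (F3) holds because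
   [{b | exists a in z, (a ⇒ b) in x}] is again a filter, which is where the
   distribution of implication over meets is used. Validity is finally tested
   at the filter generated by [phi]. *)
Require Import Defs.
From mathcomp Require Import all_boot classical_sets boolp.

Set Implicit Arguments.
Unset Strict Implicit.
Unset Printing Implicit Defensive.

Local Open Scope classical_set_scope.

Section Polarity.
Variable F : frame.
Implicit Types (A : set (W1 F)) (B : set (Wd F)).

Lemma sub_polar1K A : A `<=` polard (polar1 A).
Proof. by move=> x Ax y; apply. Qed.

Lemma sub_polardK B : B `<=` polar1 (polard B).
Proof. by move=> y By x; apply. Qed.

Lemma costable_polar1 A : costable (polar1 A).
Proof.
apply/seteqP; split; first exact: sub_polardK.
by move=> y hy x /sub_polar1K; apply: hy.
Qed.

End Polarity.

Record filter : Type := Filter {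
  mem_filter :> sentence -> Prop;
  filter_top : mem_filter Top;
  filter_up : forall a b, mem_filter a -> a ⊢ b -> mem_filter b;
  filter_and : forall a b, mem_filter a -> mem_filter b -> mem_filter (And a b)
}.

Definition principal (a : sentence) : filter.
Proof.
exists [set b | a ⊢ b].
- exact: prov_top.
- by move=> b c; apply: prov_cut.
- by move=> b c; apply: prov_and_intro.
Defined.

Definition residual (x z : filter) : filter.
Proof.
exists [set b | exists2 a, z a & x (Imp a b)].
- exists Top; first exact: filter_top.
  by apply: (filter_up (filter_top x)); apply: prov_imp_intro; apply: prov_top.
- move=> b c [a za xab] bc; exists a => //.
  by apply: (filter_up xab); apply: prov_imp_mono.
(* The antecedents [a1] and [a2] may differ. Their meet stays in [z] and, by antitonicity of
   implication on the left, serves both [b] and [c]. *)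
- move=> b c [a1 za1 xb] [a2 za2 xc]; exists (And a1 a2).
    exact: filter_and.
  have pb : x (Imp (And a1 a2) b).
    by apply: (filter_up xb); apply: prov_imp_anti; apply: prov_and_l (prov_refl _).
  have pc : x (Imp (And a1 a2) c).
    by apply: (filter_up xc); apply: prov_imp_anti; apply: prov_and_r (prov_refl _).
  exact: filter_up (filter_and pb pc) (prov_imp_and _ _ _).
Defined.

Definition imp_set (x : filter) (v : set sentence) : set sentence :=
  [set c | exists a b, [/\ x a, v b & c = Imp a b]].

Definition meets (x : filter) (y : set sentence) : Prop :=
  exists2 b, x b & y b.

Lemma meets_imp_setP (u x : filter) (v : set sentence) :
  meets u (imp_set x v) <-> meets (residual u x) v.
Proof.
split=> [[c uc [a [b [xa vb ec]]]]|[b [a xa uab] vb]].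
  by exists b => //; exists a => //; rewrite -ec.
by exists (Imp a b) => //; exists a, b.
Qed.

(** The relation [Trel] is chosen so that [Tsec x v] is the Galois closure of the single point
    [imp_set x v]; this builds (F1) in and lets the dual relation be read off from that point
    alone. *)
Definition canonical_frame : frame :=
  @Frame filter (set sentence) (inhabits (principal Top)) (inhabits set0)
    (fun x y => ~ meets x y)
    (fun y x v => forall u : filter, meets u (imp_set x v) -> meets u y).

Lemma perpE (x : W1 canonical_frame) (y : Wd canonical_frame) :
  perp x y <-> meets x y.
Proof. by split=> [/contrapT|m []]. Qed.

Lemma TsecE (x : W1 canonical_frame) (v : Wd canonical_frame) :
  Tsec x v = polar1 [set u : W1 canonical_frame | meets u (imp_set x v)].
Proof.
by apply/seteqP; split=> y hy u hu; [apply/perpE; exact: hy|apply/perpE/hy].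
Qed.

Lemma TdualE (u x : W1 canonical_frame) (v : Wd canonical_frame) :
  Tdual u x v <-> meets (residual u x) v.
Proof.
rewrite -meets_imp_setP /Tdual; split=> [h|m y h]; last exact/perpE/h.
(* The point [imp_set x v] itself belongs to [Tsec x v], so [h] may be tested there. *)
by apply/perpE; apply: h => w.
Qed.

Lemma canonical_frame_class_S : frame_class_S canonical_frame.
Proof.
split=> [x v|x v|x z].
- by rewrite TsecE; apply: costable_polar1.
- rewrite perpE; split=> [[b xb vb] u|h].
    (* The shared [b] is both antecedent and consequent: [b ⇒ b] is a theorem, hence in every
       filter. *)
    apply/TdualE; exists b => //; exists b => //.
    apply: (filter_up (filter_top u)).
    by apply: prov_imp_intro; apply: prov_refl.
  (* In the filter of theorems, membership of [a ⇒ b] amounts to [a ⊢ b], which carries [a] in [x]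
     to [b] in [x]. *)
  have /TdualE[b [a xa /= /prov_imp_elim ab] vb] := h (principal Top).
  by exists b => //; apply: filter_up xa ab.
- rewrite (_ : mkset _ = polar1 [set (residual x z : W1 canonical_frame)]).
    exact: costable_polar1.
  apply/seteqP; split=> [y /TdualE m _ ->|y h]; first exact/perpE.
  by apply/TdualE/perpE/h.
Qed.

Lemma meets_singleton (x : filter) (a : sentence) : meets x [set a] <-> x a.
Proof. by split=> [[b xb <-]|xa]; [|exists a]. Qed.

Definition extent (a : sentence) : set (W1 canonical_frame) :=
  [set x : filter | x a].

(** The least filter containing [a] is [principal a], so meeting all filters of the extent reduces
    to meeting this one. *)
Lemma polar1_extentE (a : sentence) (v : Wd canonical_frame) :
  polar1 (extent a) v <-> exists2 b, v b & a ⊢ b.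
Proof.
split=> [h|[b vb ab] x xa].
  have /perpE[b ab vb] := h (principal a) (prov_refl a).
  by exists b.
by apply/perpE; exists b => //; apply: filter_up xa ab.
Qed.

(** The singleton of [a] lies in the polar of the extent, and only filters containing [a] meet
    it. *)
Lemma extent_stable (a : sentence) : stable (extent a).
Proof.
apply/seteqP; split; first exact: sub_polar1K.
move=> x /(_ [set a])/(_ _)/perpE h; apply/meets_singleton/h.
by apply/polar1_extentE; exists a => //; apply: prov_refl.
Qed.

Definition canonical_model : model :=
  @Model canonical_frame (fun i => extent (Var i))
    (fun i => extent_stable (Var i)).

(** Truth lemma: satisfaction at a filter is membership in it. *)
Lemma interp_canonical (a : sentence) : interp canonical_model a = extent a.
Proof.
elim: a => [//||a IHa b IHb|a IHa b IHb] /=.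
- by apply/seteqP; split=> // x _; apply: filter_top.
- rewrite IHa IHb; apply/seteqP; split=> x /=; first by case; apply: filter_and.
  move=> xab; split; apply: (filter_up xab).
    exact: prov_and_l (prov_refl _).
  exact: prov_and_r (prov_refl _).
- rewrite IHa IHb; apply/seteqP; split=> u /= h.
    (* Testing at [principal a] and the singleton of [b] gives some [c] with [a ⊢ c] and [c ⇒ b] in
       [u]; antitonicity then puts [a ⇒ b] in [u]. *)
    have bb : polar1 (extent b) [set b].
      by apply/polar1_extentE; exists b => //; apply: prov_refl.
    have /TdualE/meets_singleton[c /= ac ucb] :=
      h (principal a) [set b] (prov_refl a) bb.
    by apply: (filter_up ucb); apply: prov_imp_anti.
  move=> x v xa /polar1_extentE[c vc bc]; apply/TdualE; exists c => //.
  by exists a => //; apply: (filter_up h); apply: prov_imp_mono.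
Qed.

Theorem theorem5p2 (phi psi : sentence)
  (valid : forall M : model, frame_class_S M -> interp M phi `<=` interp M psi) :
  phi ⊢ psi.
Proof.
have := valid canonical_model canonical_frame_class_S (principal phi).
by rewrite !interp_canonical; apply; apply: prov_refl.
Qed.
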